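(* Suppose $f<n$. Any $f$-FDO with finite stretch that can be queried also for non-edges must take $\Omega(fn)$ bits of space on graphs with $n$ vertices.
   Context: For a graph $G=(V,E)$ and a set $F$ of unordered vertex pairs (edges or non-edges), $G-F$ denotes $G$ with all edges of $F$ removed. $\mathrm{diam}(H)$ is the maximum shortest-path distance over pairs of vertices of $H$, $+\infty$ if $H$ is disconnected. An $f$-edge fault-tolerant diameter oracle ($f$-FDO) for $G$ is a data structure that, queried with a set $F$ with $|F|\le f$, returns a value $\widehat D$; it has stretch $\sigma\ge1$ if always $\mathrm{diam}(G-F)\le\widehat D\le\sigma\,\mathrm{diam}(G-F)$. Finite stretch means some finite $\sigma$ works. *)

(* Defs.v *)
From mathcomp Require Import all_boot all_order all_algebra.
From mathcomp Require Import all_classical all_reals ereal.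

Set Implicit Arguments.
Unset Strict Implicit.
Unset Printing Implicit Defensive.

Import Order.TTheory GRing.Theory Num.Theory.

Local Open Scope classical_set_scope.
Local Open Scope ring_scope.

Definition vpair (n : nat) : Type := {e : {set 'I_n} | #|e| == 2%N}.

(* A finite simple graph on the vertex set 'I_n is identified with its edge
   set, so that removing a set F of pairs from G, whether or not they are edges
   of G, is the set difference G :\: F. *)
Definition graph (n : nat) : Type := {set vpair n}.

Definition adj (n : nat) (G : graph n) : rel 'I_n :=
  fun u v => [exists e in G, val e == [set u; v]%SET].

Definition del_edges (n : nat) (G : graph n) (F : {set vpair n}) : graph n :=
  (G :\: F)%SET.

(* A walk from u is u :: p with p its remaining vertices, so size p counts its
   edges. The infimum over the empty set is +oo. *)
Definition dist (R : realType) (n : nat) (G : graph n) (u v : 'I_n) : \bar R :=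
  ereal_inf [set (size p)%:R%:E | p in [set p | path (adj G) u p /\ last u p = v]].

Definition diam (R : realType) (n : nat) (G : graph n) : \bar R :=
  (\big[maxe/0]_(u < n) \big[maxe/0]_(v < n) dist R G u v)%E.

(* A data structure for n-vertex graphs: preprocessing stores a bit string, and
   queries are answered from that string alone, without access to the graph. *)
Record oracle (R : realType) (n : nat) : Type := Oracle {
  build : graph n -> seq bool;
  query : seq bool -> {set vpair n} -> \bar R
}.

(* F ranges over all sets of at most f vertex pairs, non-edges of G included. *)
Definition is_fdo_with_stretch (R : realType) (n f : nat) (O : oracle R n) (sigma : R) : Prop :=
  forall (G : graph n) (F : {set vpair n}), (#|F| <= f)%N ->
    (diam R (del_edges G F) <= query O (build O G) F)%E /\
    (query O (build O G) F <= sigma%:E * diam R (del_edges G F))%E.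

Definition is_finite_stretch_fdo (R : realType) (n f : nat) (O : oracle R n) : Prop :=
  exists sigma : R, 1 <= sigma /\ is_fdo_with_stretch f O sigma.

(* Worst-case number of stored bits over the n-vertex graphs. *)
Definition oracle_space (R : realType) (n : nat) (O : oracle R n) : nat :=
  \max_(G : {set vpair n}) size (build O G).

(* Main.v *)
Require Import Defs.
From mathcomp Require Import all_boot all_order all_algebra.
From mathcomp Require Import all_classical all_reals ereal.
From mathcomp Require Import zify.

(** Finite stretch forces the answer +oo exactly when G - F is disconnected, so
    the stored string determines connectivity of G - F for every |F| <= f.
    Take m + 1 hubs, with m = min(f, n/2), and let the other k = n - m - 1
    vertices be leaves. Join hub 0 to everything and choose the m * k pairs
    (hub i > 0, leaf j) freely. Deleting all pairs between leaf j and the hubs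
    other than i costs m <= f deletions and leaves a connected graph iff
    {hub i, leaf j} is an edge. Hence the 2^(m * k) graphs are stored as distinct
    strings, and one of them has at least m * k >= f * n / 8 bits. *)

Set Implicit Arguments.
Unset Strict Implicit.
Unset Printing Implicit Defensive.

Import Order.TTheory GRing.Theory Num.Theory.

Local Open Scope ring_scope.

(** Left-padding with [false] bits and one [true] marker turns strings of varying length into words
    of exactly [s.+1] bits. The padding ends at the first [true], so it can be undone. *)
Lemma card_lt_expn_size (T : finType) (f : T -> seq bool) (s : nat) :
  injective f -> (forall x, (size (f x) <= s)%N) -> (#|T| < 2 ^ s.+1)%N.
Proof.
move=> f_inj f_size.
pose code x := nseq (s - size (f x)) false ++ true :: f x.
have size_code x : size (code x) == s.+1.
  by rewrite size_cat size_nseq /= addnS subnK.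
pose g x : s.+1.-tuple bool := Tuple (size_code x).
have codeK k y : let l := nseq k false ++ true :: y in
    drop (index true l).+1 l = y.
  by elim: k => [|k IH] /=; rewrite ?drop0.
have g_inj : injective g.
  move=> x y [] eq_code; apply: f_inj.
  by rewrite -(codeK (s - size (f x))%N (f x)) -(codeK (s - size (f y))%N (f y))
    -/(code x) -/(code y) eq_code.
have -> : (2 ^ s.+1 = #|{: s.+1.-tuple bool}|)%N by rewrite card_tuple card_bool.
rewrite -(card_codom g_inj); apply/proper_card/properP; split.
  exact/fintype.subsetP.
(* The all-[false] word has no marker, so it is not a code; this makes the bound strict. *)
exists (nseq_tuple s.+1 false) => //.
apply/negP => /codomP[x /(congr1 val) /= eqx].
have : true \in nseq s.+1 false by rewrite [nseq _ _]eqx mem_cat mem_head orbT.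
by rewrite mem_nseq andbF.
Qed.

Lemma adj_setE (n : nat) (Q : pred {set 'I_n}) (u v : 'I_n) :
  adj [set e : vpair n | Q (val e)]%SET u v = (u != v) && Q [set u; v]%SET.
Proof.
apply/existsP/andP => [[e /andP[]]|[uv Quv]].
  rewrite inE => Qe /eqP eE; rewrite -eE; split=> //.
  by move: (valP e) => /=; rewrite eE cards2; case: (u != v).
have uv2 : #|[set u; v]%SET| == 2%N by rewrite cards2 uv.
by exists (exist (fun e : {set 'I_n} => #|e| == 2%N) _ uv2); rewrite inE Quv /= eqxx.
Qed.

Lemma adj_sym (n : nat) (G : graph n) : symmetric (adj G).
Proof. by move=> u v; rewrite /adj finset.setUC. Qed.

Lemma dist_lty (R : realType) (n : nat) (G : graph n) (u v : 'I_n) :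
  connect (adj G) u v -> (dist R G u v < +oo)%E.
Proof.
move=> /connectP[p up vE]; apply: (@le_lt_trans _ _ (size p)%:R%:E); last exact: ltry.
by apply: ereal_inf_lbound; exists p.
Qed.

Lemma dist_pinfty (R : realType) (n : nat) (G : graph n) (u v : 'I_n) :
  ~~ connect (adj G) u v -> dist R G u v = +oo%E.
Proof.
move=> /negP nuv; rewrite /dist (_ : mkset _ = classical_sets.set0).
  by rewrite image_set0 ereal_inf0.
by apply/seteqP; split=> // p [up vE]; apply: nuv; apply/connectP; exists p.
Qed.

Lemma diam_lty (R : realType) (n : nat) (G : graph n) :
  (forall u v, connect (adj G) u v) -> (diam R G < +oo)%E.
Proof.
move=> Gc; rewrite /diam.
have max_lty (x y : \bar R) : (x < +oo -> y < +oo -> maxe x y < +oo)%E.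
  by rewrite gt_max => -> ->.
apply: (big_ind (fun x => x < +oo)%E) => // u _.
apply: (big_ind (fun x => x < +oo)%E) => // v _.
exact: dist_lty.
Qed.

Lemma diam_pinfty (R : realType) (n : nat) (G : graph n) (u v : 'I_n) :
  ~~ connect (adj G) u v -> diam R G = +oo%E.
Proof.
move=> /(dist_pinfty R) uv; apply/eqP; rewrite -leye_eq -uv.
apply: le_trans (le_bigmax _ _ u).
exact: (le_bigmax _ (fun v => dist R G u v) v).
Qed.

(** Equal strings would answer [F] alike: the lower bound for [G2] forces [+oo], while the stretch
    bound for [G1] is finite. *)
Lemma fdo_query_separates (R : realType) (n f : nat) (O : oracle R n)
    (G1 G2 : graph n) (F : {set vpair n}) (u v : 'I_n) :
  is_finite_stretch_fdo f O -> (#|F| <= f)%N ->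
  (forall x y, connect (adj (del_edges G1 F)) x y) ->
  ~~ connect (adj (del_edges G2 F)) u v ->
  build O G1 != build O G2.
Proof.
move=> [sigma [sigma1 fdo]] Ff /(@diam_lty R) con1 /(@diam_pinfty R) dis2.
apply/eqP => eq_build.
have [le2 _] := fdo G2 F Ff; have [_ le1] := fdo G1 F Ff.
move: le2; rewrite dis2 leye_eq -eq_build => /eqP q_oo; rewrite q_oo in le1.
have d0 : (0 <= diam R (del_edges G1 F))%E by exact: bigmax_ge_id.
have : (sigma%:E * diam R (del_edges G1 F) < +oo)%E.
  by apply: lte_mul_pinfty => //; rewrite lee_fin (le_trans ler01).
by rewrite ltNge le1.
Qed.

Section HubGraphs.
Variables m k : nat.

Let center : 'I_(m.+1 + k) := lshift k ord0.
Let hub (i : 'I_m.+1) : 'I_(m.+1 + k) := lshift k i.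
Let leaf (j : 'I_k) : 'I_(m.+1 + k) := rshift m.+1 j.

(** Hub 0 is [center]; [lift ord0] skips it, so [S] selects among the pairs of a leaf and one of the
    other [m] hubs. A predicate on bare vertex sets lets [adj_setE] apply. *)
Definition hub_edge (S : {set 'I_m * 'I_k}) : pred {set 'I_(m.+1 + k)} :=
  fun e => (center \in e) ||
    [exists p in S, e == [set hub (lift ord0 p.1); leaf p.2]%SET].

Definition hub_graph (S : {set 'I_m * 'I_k}) : graph (m.+1 + k) :=
  [set e | hub_edge S (val e)]%SET.

Definition cut_edge (i : 'I_m.+1) (j : 'I_k) : pred {set 'I_(m.+1 + k)} :=
  fun e => [exists i', (i' != i) && (e == [set hub i'; leaf j]%SET)].

(** Independent of [S], so one query serves all the hub graphs; this is where non-edges get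
    queried. *)
Definition cut (i : 'I_m.+1) (j : 'I_k) : {set vpair (m.+1 + k)} :=
  [set e | cut_edge i j (val e)]%SET.

Lemma card_cut i j : (#|cut i j| <= m)%N.
Proof.
rewrite -(card_imset _ val_inj).
have mE : (#|[set~ i]%SET| <= m)%N by rewrite cardsC1 card_ord.
apply: leq_trans mE.
apply: leq_trans (leq_imset_card (fun i' => [set hub i'; leaf j]%SET) _).
apply/subset_leq_card/fintype.subsetP => _ /imsetP[e + ->].
rewrite inE => /existsP[i' /andP[i'i /eqP eE]].
by apply/imsetP; exists i' => //; rewrite !inE.
Qed.

Lemma hub_neq_leaf i j : hub i != leaf j.
Proof. by rewrite eq_lrshift. Qed.

Lemma set2_hub_leaf i j i' j' :
  ([set hub i; leaf j] == [set hub i'; leaf j'])%SET = (i == i') && (j == j').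
Proof.
apply/eqP/andP => [eqS|[/eqP-> /eqP->]//].
have : hub i \in [set hub i'; leaf j']%SET by rewrite -eqS !inE eqxx.
have : leaf j \in [set hub i'; leaf j']%SET by rewrite -eqS !inE eqxx orbT.
rewrite !inE (negPf (hub_neq_leaf _ _)) orbF [leaf j == _]eq_sym.
by rewrite (negPf (hub_neq_leaf _ _)) eq_lshift eq_rshift.
Qed.

Lemma adj_cut S i j u v :
  adj (del_edges (hub_graph S) (cut i j)) u v =
  [&& u != v, hub_edge S [set u; v]%SET & ~~ cut_edge i j [set u; v]%SET].
Proof.
rewrite -(adj_setE (fun e => hub_edge S e && ~~ cut_edge i j e)); congr adj.
by apply/setP => e; rewrite !inE andbC.
Qed.

(** Every vertex other than [leaf j] keeps its link to [center], and [leaf j] gets there through the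
    one hub that the cut spares. *)
Lemma connect_cut (S : {set 'I_m * 'I_k}) i j u v : (i, j) \in S ->
  connect (adj (del_edges (hub_graph S) (cut (lift ord0 i) j))) u v.
Proof.
move=> ijS; set H := del_edges _ _.
have Hsym : connect_sym (adj H) by apply: sym_connect_sym; exact: adj_sym.
have to_center w : w != leaf j -> connect (adj H) w center.
  move=> wj; have [->//|wc] := eqVneq w center.
  apply: connect1; rewrite adj_cut wc /hub_edge !inE eqxx orbT /=.
  (* Every cut pair contains [leaf j], but the pair of [w] and [center] does not. *)
  apply/existsP => -[i' /andP[_ /eqP/setP/(_ (leaf j))]].
  by rewrite !inE eqxx orbT ![leaf j == _]eq_sym (negPf wj) (negPf (hub_neq_leaf _ _)).
suff all_center w : connect (adj H) w center.
  by apply: connect_trans (all_center u) _; rewrite Hsym.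
have [->|] := eqVneq w (leaf j); last exact: to_center.
apply: connect_trans (to_center (hub (lift ord0 i)) (hub_neq_leaf _ _)).
apply: connect1; rewrite adj_sym adj_cut hub_neq_leaf /=; apply/andP; split.
  by apply/orP; right; apply/existsP; exists (i, j); rewrite ijS /=.
apply/existsP => -[i' /andP[/negPf i'i]].
by rewrite set2_hub_leaf eq_sym i'i.
Qed.

(** Here [leaf j] is isolated: its edge to [center] is cut, and its other edges come from pairs
    [(i', j)] in [S], where [i'] differs from [i], so they are cut too. *)
Lemma disconnect_cut (S : {set 'I_m * 'I_k}) i j : (i, j) \notin S ->
  ~~ connect (adj (del_edges (hub_graph S) (cut (lift ord0 i) j))) (leaf j) center.
Proof.
move=> ijS; apply/negP => /connectP[[|v p]] /=.
  by move=> _ /eqP; rewrite (negPf (hub_neq_leaf _ _)).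
(* The first edge of the walk is already contradictory. *)
move=> /andP[+ _] _; rewrite adj_sym adj_cut => /and3P[vj /orP[cv|vS] /existsP ncut].
  apply: ncut; exists ord0; rewrite neq_lift /=; move: cv.
  by rewrite !inE (negPf (hub_neq_leaf _ _)) orbF => /eqP <-.
move: vS => /existsP[[i' j'] /= /andP[ijS' /eqP eE]].
have : leaf j \in [set hub (lift ord0 i'); leaf j']%SET by rewrite -eE !inE eqxx orbT.
rewrite !inE [_ == hub _]eq_sym (negPf (hub_neq_leaf _ _)) eq_rshift => /eqP jj'.
subst j'; apply: ncut; exists (lift ord0 i'); rewrite eE eqxx andbT.
by rewrite (inj_eq lift_inj); apply: contraNneq ijS => <-.
Qed.

Lemma build_hub_graph_inj (R : realType) (f : nat) (O : oracle R (m.+1 + k)) :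
  (m <= f)%N -> is_finite_stretch_fdo f O ->
  injective (fun S => build O (hub_graph S)).
Proof.
move=> mf fdo.
(* A pair [p] in only one of the two sets names the cut that tells the graphs apart. *)
have separate (S1 S2 : {set 'I_m * 'I_k}) p : p \in S1 -> p \notin S2 ->
    build O (hub_graph S1) != build O (hub_graph S2).
  case: p => i j in1 out2.
  apply: (fdo_query_separates fdo (leq_trans (card_cut (lift ord0 i) j) mf)).
    by move=> x y; exact: connect_cut.
  exact: disconnect_cut out2.
move=> S1 S2 /eqP eq_build; apply/setP => p; apply/idP/idP => pS.
  by apply: contraLR eq_build => /(separate _ _ _ pS).
by rewrite eq_sym in eq_build; apply: contraLR eq_build => /(separate _ _ _ pS).
Qed.

Lemma hub_graph_space (R : realType) (f : nat) (O : oracle R (m.+1 + k)) :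
  (m <= f)%N -> is_finite_stretch_fdo f O -> (m * k <= oracle_space O)%N.
Proof.
move=> mf fdo.
have := card_lt_expn_size (s := oracle_space O) (build_hub_graph_inj mf fdo).
(* The count reads [2 ^ (m * k) < 2 ^ s.+1] with [s] the space, and strictness absorbs the extra
   bit. *)
rewrite -cardsT -powersetT card_powerset cardsT card_prod !card_ord.
rewrite ltn_exp2l // ltnS; apply=> S.
exact: (leq_bigmax (F := fun G => size (build O G))).
Qed.

End HubGraphs.

Theorem theorem4 (R : realType) :
  exists c : R, 0 < c /\ exists n0 : nat,
    forall (n f : nat) (O : oracle R n),
      (n0 <= n)%N -> (f < n)%N -> is_finite_stretch_fdo f O ->
      c * (f%:R * n%:R) <= (oracle_space O)%:R.
Proof.
(* The 8 is the product of the factors in [f <= 2 * m] and [n <= 4 * k]. *)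
exists 8%:R^-1; split; first by rewrite invr_gt0 ltr0n.
exists 4%N => n f O n4 fn fdo.
pose m := minn f n./2; pose k := (n - m.+1)%N.
have nE : n = (m.+1 + k)%N by rewrite /k /m; lia.
have f2m : (f <= 2 * m)%N by rewrite /m; lia.
(* Since [m] is at most n/2, [k] is at least n/2 - 1, which is at least n/4 once n is at least 4. *)
have n4k : (n <= 4 * k)%N by rewrite /k /m; lia.
have mf : (m <= f)%N by rewrite geq_minl.
have space : (m * k <= oracle_space O)%N.
  clearbody m k; move: O fdo; rewrite nE => O fdo.
  exact: hub_graph_space mf fdo.
rewrite ler_pdivrMl ?ltr0n // -!natrM ler_nat.
apply: leq_trans (leq_mul f2m n4k) _; lia.
Qed.
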